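(* Let $f \colon \mathbb{R}^n \to \mathbb{R}$, $g \colon \mathbb{R}^n \to \mathbb{R}^m$, $h \colon \mathbb{R}^n \to \mathbb{R}^p$ be continuously differentiable, let $\rho > 0$, let $X := \{ x \in \mathbb{R}^n \mid g(x) \le 0, \ h(x) = 0, \ x \ge 0 \}$, and let $p^\rho(y) = \sum_{i=1}^n p_i^\rho(y_i)$ with each $p_i^\rho$ satisfying (P.1)--(P.3) stated in the context. Let $x^* \in X$ and let $y^* \in \mathbb{R}^n$ be given by $y_i^* = s_i^\rho$ if $x_i^* = 0$ and $y_i^* = 0$ otherwise. Then the following statements are equivalent: (a) $x^*$ is an S-stationary point of the problem (SPO): $\min_x f(x) + \rho\|x\|_0$ s.t. $x \in X$. (b) The KKT conditions of (SPOref) are satisfied at $(x^*, y^* )$. (c) The KKT conditions of (SPOcp) are satisfied at $(x^*, y^* )$.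
   Context: Notation: $\|x\|_0$ is the number of nonzero components of $x$; $I_0(x) := \{ i \mid x_i = 0\}$; $x \circ y$ is the componentwise product. Conditions on $p_i^\rho \colon \mathbb{R} \to \mathbb{R}$, $i=1,\dots,n$: (P.1) $p_i^\rho$ is convex and attains a unique minimum at some point $s_i^\rho > 0$; (P.2) $p_i^\rho(0) - p_i^\rho(s_i^\rho) = \rho$; (P.3) $p_i^\rho$ is continuously differentiable. SP-Lagrangian: $L^{SP}(x,\lambda,\mu) := f(x) + \lambda^T g(x) + \mu^T h(x)$. S-stationarity: $x^* \in X$ is an S-stationary point of (SPO) if there exist $\lambda^* \in \mathbb{R}^m$, $\mu^* \in \mathbb{R}^p$ such that $\nabla_{x_i} L^{SP}(x^*,\lambda^*,\mu^* ) = 0$ for all $i \notin I_0(x^* )$, $h(x^* ) = 0$, and $\lambda^* \ge 0$, $g(x^* ) \le 0$, $\lambda^* \circ g(x^* ) = 0$. Reformulations (both smooth nonlinear programs in $(x,y) \in \mathbb{R}^n \times \mathbb{R}^n$): (SPOref): $\min f(x) + p^\rho(y)$ s.t. $g(x) \le 0$, $h(x) = 0$, $x \ge 0$, $x \circ y = 0$. (SPOcp): $\min f(x) + p^\rho(y)$ s.t. $g(x) \le 0$, $h(x) = 0$, $x \circ y = 0$, $x \ge 0$, $y \ge 0$. ''KKT conditions'' are the standard Karush–Kuhn–Tucker conditions of these nonlinear programs, with the $n$ equality constraints $x_i y_i = 0$ treated as ordinary equality constraints. *)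

(* Defs.v *)
From HB Require Import structures.
From mathcomp Require Import all_boot all_order all_algebra.
From mathcomp Require Import all_classical all_reals all_analysis.

Set Implicit Arguments.
Unset Strict Implicit.
Unset Printing Implicit Defensive.

Import Order.TTheory GRing.Theory Num.Theory.
Import numFieldNormedType.Exports.

Local Open Scope classical_set_scope.
Local Open Scope ring_scope.

Section Vectors.
Context {R : realType}.

(* MathComp puts no order on matrices. *)
Definition vle n (u v : 'rV[R]_n) : Prop := forall i, u 0 i <= v 0 i.

Definition dot n (u v : 'rV[R]_n) : R := \sum_i u 0 i * v 0 i.

Definition cmul n (u v : 'rV[R]_n) : 'rV[R]_n := \row_i (u 0 i * v 0 i).

Definition I0 n (x : 'rV[R]_n) : {set 'I_n} := finset (fun i => x 0 i == 0).

Definition gradient n (f : 'rV[R]_n -> R) (x : 'rV[R]_n) : 'rV[R]_n :=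
  \row_i 'D_(delta_mx 0 i) f x.

(* The domain is finite-dimensional, so continuity of x |-> 'd f x is
   equivalent to continuity of x |-> 'd f x v for every v. *)
Definition continuously_differentiable n (W : normedModType R)
    (f : 'rV[R]_n -> W) : Prop :=
  (forall x, differentiable f x) /\ (forall v, continuous (fun x => 'd f x v)).

End Vectors.

Section NonlinearProgram.
Context {R : realType}.

Definition lagrangian n m p (f : 'rV[R]_n -> R) (g : 'rV[R]_n -> 'rV[R]_m)
    (h : 'rV[R]_n -> 'rV[R]_p) (lam : 'rV[R]_m) (mu : 'rV[R]_p)
    (x : 'rV[R]_n) : R :=
  f x + dot lam (g x) + dot mu (h x).

(* KKT conditions of: min f(x) s.t. g(x) <= 0, h(x) = 0. *)
Definition KKT n m p (f : 'rV[R]_n -> R) (g : 'rV[R]_n -> 'rV[R]_m)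
    (h : 'rV[R]_n -> 'rV[R]_p) (x : 'rV[R]_n) : Prop :=
  exists (lam : 'rV[R]_m) (mu : 'rV[R]_p),
    [/\ gradient (lagrangian f g h lam mu) x = 0,
        h x = 0
      & [/\ vle 0 lam, vle (g x) 0 & cmul lam (g x) = 0]].

End NonlinearProgram.

Section Penalty.
Context {R : realType}.

Definition P1 (p : R -> R) (s : R) : Prop :=
  [/\ convex_function [set: R^o] (p : R^o -> R^o),
      unique (fun t => forall u, p t <= p u) s
    & 0 < s].

Definition P2 (rho : R) (p : R -> R) (s : R) : Prop := p 0 - p s = rho.

Definition P3 (p : R -> R) : Prop :=
  (forall t, derivable p t 1) /\ continuous (derive1 p).

Definition penalty n (p : 'I_n -> R -> R) (y : 'rV[R]_n) : R :=
  \sum_i p i (y 0 i).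

End Penalty.

Section SparseOptimization.
Context {R : realType} {n m p : nat}.
Variables (f : 'rV[R]_n -> R) (g : 'rV[R]_n -> 'rV[R]_m)
  (h : 'rV[R]_n -> 'rV[R]_p).

Definition feasible (x : 'rV[R]_n) : Prop :=
  [/\ vle (g x) 0, h x = 0 & vle 0 x].

(* S-stationarity for: min f(x) + rho * ||x||_0 s.t. [feasible x].  The notion
   involves neither rho nor a multiplier for x >= 0. *)
Definition S_stationary (x : 'rV[R]_n) : Prop :=
  feasible x /\
  exists (lam : 'rV[R]_m) (mu : 'rV[R]_p),
    [/\ forall i, i \notin I0 x -> gradient (lagrangian f g h lam mu) x 0 i = 0,
        h x = 0
      & [/\ vle 0 lam, vle (g x) 0 & cmul lam (g x) = 0]].

(* The variable (x, y) is encoded as z = row_mx x y. *)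
Definition ref_objective (q : 'I_n -> R -> R) (z : 'rV[R]_(n + n)) : R :=
  f (lsubmx z) + penalty q (rsubmx z).

Definition ref_eq (z : 'rV[R]_(n + n)) : 'rV[R]_(p + n) :=
  row_mx (h (lsubmx z)) (cmul (lsubmx z) (rsubmx z)).

Definition SPOref_ineq (z : 'rV[R]_(n + n)) : 'rV[R]_(m + n) :=
  row_mx (g (lsubmx z)) (- lsubmx z).

Definition SPOcp_ineq (z : 'rV[R]_(n + n)) : 'rV[R]_(m + (n + n)) :=
  row_mx (g (lsubmx z)) (row_mx (- lsubmx z) (- rsubmx z)).

Definition SPOref_KKT (q : 'I_n -> R -> R) (x y : 'rV[R]_n) : Prop :=
  KKT (ref_objective q) SPOref_ineq ref_eq (row_mx x y).

Definition SPOcp_KKT (q : 'I_n -> R -> R) (x y : 'rV[R]_n) : Prop :=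
  KKT (ref_objective q) SPOcp_ineq ref_eq (row_mx x y).

End SparseOptimization.

(* Main.v *)
Require Import Defs.
From HB Require Import structures.
From mathcomp Require Import all_boot all_order all_algebra.
From mathcomp Require Import ring lra.
From mathcomp Require Import all_classical all_reals all_analysis.
Import Order.TTheory GRing.Theory Num.Theory.
Import numFieldNormedType.Exports.
Local Open Scope classical_set_scope.
Local Open Scope ring_scope.

(** Both reformulations are governed by one Lagrangian, because (SPOref) is
    (SPOcp) with the multiplier of y >= 0 set to zero ([lagrangian_refE]).
    With multipliers la, lx, ly for g(x) <= 0, -x <= 0, -y <= 0 and ma, me for
    h(x) = 0, x o y = 0, that Lagrangian is L^SP(x, la, ma) plus the separable
    sum of q_i(y_i) + me_i x_i y_i - lx_i x_i - ly_i y_i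
    ([lagrangian_cpE]), so stationarity in (x, y) reads
    ([gradient_lagrangian_cp])
      - grad_i L^SP(x, la, ma) + me_i y_i - lx_i = 0, and
      - q_i'(y_i) + me_i x_i - ly_i = 0.

    From S-stationarity to the KKT conditions of (SPOref): take lx = 0.  At the
    point y = y*, exactly one of x_i and y_i is nonzero, so me_i appears in
    exactly one of the two equations, which can be solved for it.  If x_i = 0,
    then y_i = s_i > 0 and the x-equation gives me_i, while the y-equation is
    q_i'(s_i) = 0, true since s_i minimizes q_i.  If x_i <> 0, then y_i = 0,
    the y-equation gives me_i, and the x-equation is S-stationarity
    ([S_stationary_SPOref_KKT]).

    From (SPOref) to (SPOcp): keep the multipliers and take ly = 0; y* >= 0
    ([SPOref_KKT_SPOcp_KKT]).

    From (SPOcp) to S-stationarity: where x_i <> 0, complementarity with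
    x >= 0 gives lx_i = 0 and the constraint x_i y_i = 0 gives y_i = 0, so the
    x-equation collapses to grad_i L^SP = 0 ([SPOcp_KKT_S_stationary]). *)

(** * Gradients *)

Lemma gradientD {R : realType} {n} {F G : 'rV[R]_n -> R} {z} :
  differentiable F z -> differentiable G z ->
  gradient (F + G) z = gradient F z + gradient G z.
Proof.
move=> dF dG; apply/rowP => i; rewrite !mxE.
by apply: deriveD; exact: diff_derivable.
Qed.

Lemma gradient_cst {R : realType} {n} (c : R) (z : 'rV[R]_n) :
  gradient (cst c) z = 0.
Proof. by apply/rowP => i; rewrite !mxE derive_cst. Qed.

(** A directional derivative sees only the increments of the function along its
    line, so it can be computed in another space where they are the same: the
    two difference quotients are equal functions of t.  The gradients of block
    functions and of separable sums both reduce to this. *)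
Lemma eq_derive_line {R : realType} {V V' : normedModType R}
    (F : V -> R) (G : V' -> R) (a v : V) (b w : V') :
  (forall t, F (t *: v + a) - F a = G (t *: w + b) - G b) ->
  'D_v F a = 'D_w G b.
Proof.
move=> FG; rewrite /derive.
suff -> : (fun t : R => t^-1 *: ((F \o shift a) (t *: v) - F a)) =
          (fun t : R => t^-1 *: ((G \o shift b) (t *: w) - G b)) by [].
by apply/funext => t /=; rewrite FG.
Qed.

Lemma gradient_row_mx {R : realType} {n1 n2} (F : 'rV[R]_(n1 + n2) -> R) x y :
  gradient F (row_mx x y) =
  row_mx (gradient (fun u => F (row_mx u y)) x)
         (gradient (fun u => F (row_mx x u)) y).
Proof.
apply/rowP => k; case: (split_ordP k) => i ->.
- rewrite row_mxEl !mxE; apply: eq_derive_line => t.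
  rewrite delta_mx_lshift scale_row_mx scaler0.
  by rewrite add_row_mx add0r.
- rewrite row_mxEr !mxE; apply: eq_derive_line => t.
  rewrite delta_mx_rshift scale_row_mx scaler0.
  by rewrite add_row_mx add0r.
Qed.

Lemma penaltyE {R : realType} {n} (q : 'I_n -> R -> R) :
  penalty q = \sum_i (fun z : 'rV[R]_n => q i (z 0 i)).
Proof. by apply/funext => z; rewrite fct_sumE. Qed.

Lemma differentiable_penalty {R : realType} {n} {q : 'I_n -> R -> R}
    {y : 'rV[R]_n} :
  (forall i, derivable (q i) (y 0 i) 1) -> differentiable (penalty q) y.
Proof.
move=> dq; rewrite penaltyE.
apply: (@differentiable_sum R _ _ n (fun i (z : 'rV[R]_n) => q i (z 0 i)) y) => i.
have dqi : differentiable (q i) (y 0 i) by apply/derivable1_diffP.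
exact: (differentiable_comp (differentiable_coord y 0 i) dqi).
Qed.

(** Moving along the i-th axis changes only the i-th summand, so the partial
    derivative is the derivative of [q i], by [eq_derive_line]. *)
Lemma gradient_penalty {R : realType} {n} (q : 'I_n -> R -> R) (y : 'rV[R]_n) :
  gradient (penalty q) y = \row_i derive1 (q i) (y 0 i).
Proof.
apply/rowP => i; rewrite !mxE derive1E; apply: eq_derive_line => t.
rewrite /penalty (bigD1 i)//= [X in _ - X](bigD1 i)//= !mxE !eqxx.
rewrite opprD addrACA [X in _ + X](_ : _ = 0) ?addr0 //.
apply/eqP; rewrite subr_eq0; apply/eqP; apply: eq_bigr => j ji.
by rewrite !mxE eqxx (negbTE ji) /= mulr0 add0r.
Qed.

Lemma differentiable_dot {R : realType} {n k} (w : 'rV[R]_k)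
    {F : 'rV[R]_n -> 'rV[R]_k} {z} :
  differentiable F z -> differentiable (fun u => dot w (F u)) z.
Proof.
move=> dF; apply: (@differentiable_comp _ _ _ _ F (dot w)) => //.
(* [dot w] is the separable sum of the maps t |-> w_i t. *)
apply: (@differentiable_penalty _ _ (fun i t => w 0 i * t)) => i.
by apply: derivableM.
Qed.

Lemma differentiable_lagrangian {R : realType} {n m p} {f : 'rV[R]_n -> R}
    {g : 'rV[R]_n -> 'rV[R]_m} {h : 'rV[R]_n -> 'rV[R]_p} lam mu {x} :
  differentiable f x -> differentiable g x -> differentiable h x ->
  differentiable (lagrangian f g h lam mu) x.
Proof.
move=> df dg dh.
by apply: differentiableD; [apply: differentiableD|]; rewrite //;
  exact: differentiable_dot.
Qed.

Lemma derive1_global_min {R : realType} (q : R -> R) (s : R) :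
  (forall t, derivable q t 1) -> (forall t, q s <= q t) -> derive1 q s = 0.
Proof.
move=> dq qs; rewrite derive1E.
have le : s - 1 <= s + 1 by lra.
have sin : s \in `]s - 1, s + 1[ by rewrite in_itv/=; lra.
by have [] := derive1_at_min le (fun t _ => dq t) sin (fun t _ => qs t).
Qed.

(** * Vectors in blocks *)

Lemma dot_row_mx {R : realType} {n1 n2} (u1 v1 : 'rV[R]_n1) (u2 v2 : 'rV[R]_n2) :
  dot (row_mx u1 u2) (row_mx v1 v2) = dot u1 v1 + dot u2 v2.
Proof.
rewrite /dot big_split_ord /=.
by congr (_ + _); apply: eq_bigr => i _; rewrite ?row_mxEl ?row_mxEr.
Qed.

Lemma cmul_row_mx {R : realType} {n1 n2} (u1 v1 : 'rV[R]_n1) (u2 v2 : 'rV[R]_n2) :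
  cmul (row_mx u1 u2) (row_mx v1 v2) = row_mx (cmul u1 v1) (cmul u2 v2).
Proof.
apply/rowP => k; case: (split_ordP k) => i ->.
- by rewrite [LHS]mxE !row_mxEl mxE.
- by rewrite [LHS]mxE !row_mxEr mxE.
Qed.

Lemma vle_row_mx {R : realType} {n1 n2} (u1 v1 : 'rV[R]_n1) (u2 v2 : 'rV[R]_n2) :
  vle (row_mx u1 u2) (row_mx v1 v2) <-> vle u1 v1 /\ vle u2 v2.
Proof.
split=> [le12|[le1 le2] k].
  by split=> i; [have := le12 (lshift n2 i)|have := le12 (rshift n1 i)];
    rewrite ?row_mxEl ?row_mxEr.
by case: (split_ordP k) => i ->; rewrite ?row_mxEl ?row_mxEr.
Qed.

Lemma vle0_row_mx {R : realType} {n1 n2} (u1 : 'rV[R]_n1) (u2 : 'rV[R]_n2) :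
  vle 0 (row_mx u1 u2) <-> vle 0 u1 /\ vle 0 u2.
Proof. by rewrite -[X in vle X _]row_mx0; exact: vle_row_mx. Qed.

Lemma vle_row_mx0 {R : realType} {n1 n2} (u1 : 'rV[R]_n1) (u2 : 'rV[R]_n2) :
  vle (row_mx u1 u2) 0 <-> vle u1 0 /\ vle u2 0.
Proof. by rewrite -[X in vle _ X]row_mx0; exact: vle_row_mx. Qed.

Lemma vle_oppr0 {R : realType} {n} (u : 'rV[R]_n) : vle (- u) 0 <-> vle 0 u.
Proof. by split=> u0 i; have := u0 i; rewrite !mxE oppr_le0. Qed.

Lemma cmul0l {R : realType} {n} (u : 'rV[R]_n) : cmul 0 u = 0.
Proof. by apply/rowP => i; rewrite !mxE mul0r. Qed.

Lemma row_mx_eq0P {R : realType} {n1 n2} (u1 : 'rV[R]_n1) (u2 : 'rV[R]_n2) :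
  row_mx u1 u2 = 0 <-> u1 = 0 /\ u2 = 0.
Proof. by rewrite -row_mx0; split=> [/eq_row_mx|[-> ->]]. Qed.

(** * The Lagrangians of the reformulations *)

Section Reformulations.
Context {R : realType} {n m p : nat}.
Context {f : 'rV[R]_n -> R} {g : 'rV[R]_n -> 'rV[R]_m} {h : 'rV[R]_n -> 'rV[R]_p}.
Context {q : 'I_n -> R -> R}.

Lemma lagrangian_cpE la lx ly ma me (x y : 'rV[R]_n) :
  lagrangian (ref_objective f q) (SPOcp_ineq g) (ref_eq h)
    (row_mx la (row_mx lx ly)) (row_mx ma me) (row_mx x y) =
  lagrangian f g h la ma x +
  \sum_i (q i (y 0 i) + me 0 i * (x 0 i * y 0 i)
          - lx 0 i * x 0 i - ly 0 i * y 0 i).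
Proof.
rewrite /lagrangian /ref_objective /SPOcp_ineq /ref_eq row_mxKl row_mxKr.
rewrite !dot_row_mx !sumrB big_split /=.
have dotN k (u v : 'rV[R]_k) : dot u (- v) = - (\sum_i u 0 i * v 0 i).
  by rewrite /dot -sumrN; apply: eq_bigr => i _; rewrite mxE mulrN.
rewrite !dotN.
have -> : dot me (cmul x y) = \sum_i me 0 i * (x 0 i * y 0 i).
  by apply: eq_bigr => i _; rewrite mxE.
rewrite /penalty; ring.
Qed.

(** In each block of variables the Lagrangian is, up to a constant, the sum of
    a function whose gradient is known and a separable sum of functions of one
    variable. *)
Lemma gradient_lagrangian_cp la lx ly ma me (x y : 'rV[R]_n) :
  differentiable f x -> differentiable g x -> differentiable h x ->
  (forall i, derivable (q i) (y 0 i) 1) ->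
  gradient (lagrangian (ref_objective f q) (SPOcp_ineq g) (ref_eq h)
    (row_mx la (row_mx lx ly)) (row_mx ma me)) (row_mx x y) =
  row_mx (gradient (lagrangian f g h la ma) x + cmul me y - lx)
    ((\row_i derive1 (q i) (y 0 i)) + cmul me x - ly).
Proof.
move=> df dg dh dq; rewrite gradient_row_mx; congr row_mx.
- pose a (i : 'I_n) (t : R) : R :=
    q i (y 0 i) + me 0 i * (t * y 0 i) - lx 0 i * t - ly 0 i * y 0 i.
  have da i (t : R) : is_derive t (1 : R) (a i) (me 0 i * y 0 i - lx 0 i).
    rewrite /a; apply: is_derive_eq; rewrite /GRing.scale/=; ring.
  rewrite (_ : (fun _ => _) = lagrangian f g h la ma + penalty a); last first.
    by apply/funext => u; rewrite lagrangian_cpE.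
  rewrite gradientD ?gradient_penalty; first last.
  + by apply: differentiable_penalty => i; case: (da i (x 0 i)).
  + exact: differentiable_lagrangian.
  rewrite -addrA; congr (_ + _); apply/rowP => i.
  by rewrite !mxE derive1E derive_val.
- pose b (i : 'I_n) (t : R) : R :=
    q i t + me 0 i * (x 0 i * t) - lx 0 i * x 0 i - ly 0 i * t.
  have db i : is_derive (y 0 i) (1 : R) (b i)
      (derive1 (q i) (y 0 i) + me 0 i * x 0 i - ly 0 i).
    have /derivableP := dq i; rewrite -derive1E => dqi.
    rewrite /b; apply: is_derive_eq; rewrite /GRing.scale/=; ring.
  rewrite (_ : (fun _ => _) = cst (lagrangian f g h la ma x) + penalty b);
    last by apply/funext => u; rewrite lagrangian_cpE.
  rewrite gradientD ?gradient_penalty ?gradient_cst ?add0r; first last.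
  + by apply: differentiable_penalty => i; case: (db i).
  + exact: differentiable_cst.
  by apply/rowP => i; rewrite !mxE derive1E derive_val.
Qed.

(** Lets the gradient formula for (SPOcp) serve for (SPOref) as well. *)
Lemma lagrangian_refE la lx mu :
  lagrangian (ref_objective f q) (SPOref_ineq g) (ref_eq h) (row_mx la lx) mu =
  lagrangian (ref_objective f q) (SPOcp_ineq g) (ref_eq h)
    (row_mx la (row_mx lx 0)) mu :> ('rV[R]_(n + n) -> R).
Proof.
apply/funext => z; rewrite /lagrangian /SPOref_ineq /SPOcp_ineq !dot_row_mx.
by rewrite [dot 0 _]big1 ?addr0// => i _; rewrite mxE mul0r.
Qed.

(** * The three implications *)

(** The multiplier [me] of the constraint x o y = 0 is free in sign, and each
    of its components multiplies exactly one nonzero coordinate, [x 0 i] or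
    [y 0 i]; dividing by that coordinate solves one stationarity equation, and
    the other holds by hypothesis. *)
Lemma S_stationary_SPOref_KKT (s : 'I_n -> R) (x y : 'rV[R]_n) :
  differentiable f x -> differentiable g x -> differentiable h x ->
  (forall i, derivable (q i) (y 0 i) 1) ->
  (forall i, s i != 0) -> (forall i, derive1 (q i) (s i) = 0) ->
  (forall i, y 0 i = if x 0 i == 0 then s i else 0) ->
  S_stationary f g h x -> SPOref_KKT f g h q x y.
Proof.
move=> df dg dh dq s0 q's yE [[_ _ x0] [la [ma [gradL hx [la0 gx lag]]]]].
pose me : 'rV[R]_n := \row_i (if x 0 i == 0
  then - gradient (lagrangian f g h la ma) x 0 i / s i
  else - derive1 (q i) 0 / x 0 i).
exists (row_mx la 0), (row_mx ma me); split.
- rewrite lagrangian_refE gradient_lagrangian_cp//.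
  rewrite !subr0 -[RHS]row_mx0; congr row_mx; apply/rowP => i.
  + rewrite mxE [cmul _ _ 0 i]mxE [me 0 i]mxE [RHS]mxE yE.
    case: eqVneq => xi; first by rewrite divfK// addrN.
    by rewrite mulr0 addr0 gradL// inE.
  + rewrite !mxE yE; case: eqVneq => xi; first by rewrite q's xi mulr0 addr0.
    by rewrite divfK// addrN.
- rewrite /ref_eq row_mxKl row_mxKr hx -[RHS]row_mx0; congr row_mx.
  apply/rowP => i; rewrite !mxE yE.
  by case: eqVneq => [->|_]; rewrite ?mul0r ?mulr0.
- rewrite /SPOref_ineq row_mxKl; split.
  + by apply/vle0_row_mx; split=> // i.
  + by apply/vle_row_mx0; split=> //; apply/vle_oppr0.
  + by rewrite cmul_row_mx lag cmul0l row_mx0.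
Qed.

(** A new constraint that holds at the point may be given the multiplier 0. *)
Lemma SPOref_KKT_SPOcp_KKT (x y : 'rV[R]_n) :
  vle 0 y -> SPOref_KKT f g h q x y -> SPOcp_KKT f g h q x y.
Proof.
move=> y0 [lam [mu]]; rewrite -(hsubmxK lam).
set la := lsubmx lam; set lx := rsubmx lam.
rewrite lagrangian_refE /SPOref_ineq row_mxKl.
move=> [gradL feq [lam0 gx lamg]].
exists (row_mx la (row_mx lx 0)), mu; split=> //.
rewrite /SPOcp_ineq row_mxKl row_mxKr.
rewrite !cmul_row_mx in lamg *.
move: lam0 gx lamg.
move=> /vle0_row_mx[la0 lx0] /vle_row_mx0[gx xneg] /row_mx_eq0P[lag lxx].
split.
- by apply/vle0_row_mx; split=> //; apply/vle0_row_mx; split=> // i.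
- apply/vle_row_mx0; split=> //; apply/vle_row_mx0.
  by split=> //; apply/vle_oppr0.
- by rewrite lag lxx cmul0l !row_mx0.
Qed.

(** Where x_i <> 0, both extra terms of the i-th x-equation vanish: lx_i by
    complementarity, and me_i y_i because y_i = 0 by feasibility of
    x o y = 0. *)
Lemma SPOcp_KKT_S_stationary (x y : 'rV[R]_n) :
  differentiable f x -> differentiable g x -> differentiable h x ->
  (forall i, derivable (q i) (y 0 i) 1) ->
  SPOcp_KKT f g h q x y -> S_stationary f g h x.
Proof.
move=> df dg dh dq [lam [mu]].
rewrite -(hsubmxK lam) -(hsubmxK (rsubmx lam)) -(hsubmxK mu).
set la := lsubmx lam; set lx := lsubmx (rsubmx lam).
set ly := rsubmx (rsubmx lam); set ma := lsubmx mu; set me := rsubmx mu.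
(* Opaque blocks: [mxE] would otherwise unfold them into entries of [lam]. *)
clearbody la lx ly ma me.
rewrite gradient_lagrangian_cp// /ref_eq /SPOcp_ineq !row_mxKl !row_mxKr.
rewrite !cmul_row_mx.
move=> [/row_mx_eq0P[gradx _] /row_mx_eq0P[hx xy]].
move=> [/vle0_row_mx[la0 _] /vle_row_mx0[gx /vle_row_mx0[/vle_oppr0 x0 _]]].
move=> /row_mx_eq0P[lag /row_mx_eq0P[lxx _]].
split=> //; exists la, ma; split=> // i; rewrite inE => xi.
have /eqP := congr1 (fun u : 'rV_n => u 0 i) lxx.
rewrite !mxE mulf_eq0 oppr_eq0 (negbTE xi) orbF => /eqP lxi.
have /eqP := congr1 (fun u : 'rV_n => u 0 i) xy.
rewrite !mxE mulf_eq0 (negbTE xi) => /eqP yi.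
have := congr1 (fun u : 'rV_n => u 0 i) gradx.
rewrite 2!mxE [(- lx) 0 i]mxE [cmul _ _ 0 i]mxE lxi yi mulr0 subr0 addr0.
by rewrite !mxE.
Qed.

End Reformulations.

Theorem theorem4p3 (R : realType) (n m p : nat)
    (f : 'rV[R]_n -> R) (g : 'rV[R]_n -> 'rV[R]_m) (h : 'rV[R]_n -> 'rV[R]_p)
    (f_C1 : continuously_differentiable f)
    (g_C1 : continuously_differentiable g)
    (h_C1 : continuously_differentiable h)
    (rho : R) (rho_gt0 : 0 < rho)
    (q : 'I_n -> R -> R) (s : 'I_n -> R)
    (qP1 : forall i, P1 (q i) (s i))
    (qP2 : forall i, P2 rho (q i) (s i))
    (qP3 : forall i, P3 (q i))
    (x y : 'rV[R]_n)
    (xX : feasible g h x)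
    (yE : forall i, y 0 i = if x 0 i == 0 then s i else 0) :
  [<-> S_stationary f g h x;
       SPOref_KKT f g h q x y;
       SPOcp_KKT f g h q x y].
Proof.
have [df dg dh] : [/\ differentiable f x, differentiable g x
                    & differentiable h x].
  by split; [exact: f_C1.1|exact: g_C1.1|exact: h_C1.1].
have dq i t : derivable (q i) t 1 by exact: (qP3 i).1.
have s_gt0 i : 0 < s i by case: (qP1 i).
have q's i : derive1 (q i) (s i) = 0.
  by apply: derive1_global_min => //; case: (qP1 i) => _ [].
tfae.
- by apply: (S_stationary_SPOref_KKT s) => // i; exact: lt0r_neq0.
- apply: SPOref_KKT_SPOcp_KKT => i; rewrite mxE yE.
  by case: ifP => // _; exact: ltW.
- exact: SPOcp_KKT_S_stationary.
Qed.
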